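(* Let $R$ be a left (resp., right) Artinian ring and $n\ge 1$ a natural number. Then the following are equivalent: (i) $R$ is a $U\sqrt{\Delta}$-ring; (ii) $R$ is a $UN$-ring; (iii) $M_n(R)$ is a $UN$-ring; (iv) $M_n(R)$ is a $U\sqrt{\Delta}$-ring.
   Context: All rings are associative with identity. $M_n(R)$ is the ring of $n\times n$ matrices over $R$. For a ring $R$, $U(R)$ is its group of units, $\Delta(R)=\{x\in R \mid x+u\in U(R)\text{ for all }u\in U(R)\}$, and $\sqrt{\Delta(R)}=\{x\in R\mid x^n\in\Delta(R)\text{ for some integer }n\ge 1\}$. A ring $R$ is a $U\sqrt{\Delta}$-ring if every non-unit $a\in R$ can be written as $a=ub$ with $u\in U(R)$ and $b\in\sqrt{\Delta(R)}$. A ring $R$ is a $UN$-ring if every non-unit of $R$ is the product of a unit and a nilpotent element. *)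

(* Defs.v *)
From mathcomp Require Import all_boot all_algebra.
From mathcomp Require Import boolp classical_sets.

Set Implicit Arguments.
Unset Strict Implicit.
Unset Printing Implicit Defensive.

Import GRing.Theory.

Local Open Scope classical_set_scope.
Local Open Scope ring_scope.

Section Rings.

(* Associative rings with identity, possibly noncommutative.  [pzRingType] is
   used (rather than [unitRingType]) because MathComp gives ['M[R]_n] no
   [unitRingType] structure over a noncommutative [R]; hence the set of units is
   defined below by two-sided invertibility.  The zero ring is not excluded. *)
Variable R : pzRingType.

Definition units : set R := [set u | exists v, v * u = 1 /\ u * v = 1].

Definition Delta : set R := [set x | forall u, units u -> units (x + u)].

Definition sqrtDelta : set R :=
  [set x | exists n : nat, (1 <= n)%N /\ Delta (x ^+ n)].

Definition nilpotents : set R :=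
  [set x | exists n : nat, (1 <= n)%N /\ x ^+ n = 0].

Definition USqrtDelta_ring : Prop :=
  forall a : R, ~ units a ->
    exists u b, [/\ units u, sqrtDelta b & a = u * b].

Definition UN_ring : Prop :=
  forall a : R, ~ units a ->
    exists u b, [/\ units u, nilpotents b & a = u * b].

(* MathComp's [idealr] structure concerns decidable, proper left ideals of
   nonzero rings; the chain conditions need arbitrary one-sided ideals. *)
Definition left_ideal (I : set R) : Prop :=
  [/\ I 0, forall x y, I x -> I y -> I (x - y) & forall a x, I x -> I (a * x)].

Definition right_ideal (I : set R) : Prop :=
  [/\ I 0, forall x y, I x -> I y -> I (x - y) & forall a x, I x -> I (x * a)].

Definition dcc (P : set (set R)) : Prop :=
  forall I : nat -> set R,
    (forall k, P (I k)) -> (forall k, I k.+1 `<=` I k) ->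
    exists m, forall k, (m <= k)%N -> I k = I m.

Definition left_artinian : Prop := dcc left_ideal.

Definition right_artinian : Prop := dcc right_ideal.

End Rings.

Arguments USqrtDelta_ring R : clear implicits.
Arguments UN_ring R : clear implicits.
Arguments left_artinian R : clear implicits.
Arguments right_artinian R : clear implicits.

(* Main.v *)
Require Import Defs.
From mathcomp Require Import all_boot all_algebra.
From mathcomp Require Import boolp classical_sets.

Set Implicit Arguments.
Unset Strict Implicit.
Unset Printing Implicit Defensive.

Import GRing.Theory.

(** The four conditions are compared through a fifth one, which passes between
    [R] and its matrix rings: primeness of the Jacobson radical [J], in the form
    [h R e] inside [J] forces [h] or [e] into [J].  (For an Artinian ring this
    says that [R / J] is simple Artinian or zero.)

    Only two consequences of an Artinian hypothesis are used, and both are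
    left-right symmetric.
    - Every [x] has a Drazin inverse [w] ([artinian_drazin]).  With the
      idempotent [e = x w] it splits [x] into a part that is invertible in the
      corner [e R e] and a nilpotent part in [(1 - e) R (1 - e)].  Left
      pi-regularity is immediate from the chain condition, and Dischinger's
      argument ([left_pi_regular_group_regular]) gives the right-hand half.
    - Every nonempty set of idempotents has a minimal element for
      [e <= f <-> e f = f e = e] ([artinian_idempotent_min]).

    Drazin inverses make [Delta R] nil: for [x] in [Delta R] the unit
    [u = (1 - e) - x e] turns [x + u] into an element killed by [e], so [e = 0]
    and [x] is nilpotent.  Hence the U-sqrt-Delta and UN conditions agree.

    UN implies that [J] is prime ([UN_radical_is_prime]): if [h R e] lies in [J],
    the elements [x] with [h R x] inside [J] form an ideal [I], and some
    idempotent [g] of [I] satisfies [(1 - g) I <= J].  If [g = 1], then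
    [h] is in [J].  Otherwise [g = u b] with [b] nilpotent; then [b] is in [I], so [b = g b] modulo [J],
    and iterating, [g = u^k b^k] modulo [J].  So [g] is in [J], [g = 0] and
    [e] is in [J].

    Conversely, let [J] be prime ([radical_is_prime_UN]).  Up to a unit on the left,
    a non-unit [a] is [e + z] modulo [J], with [e] idempotent and [z] nilpotent
    in [(1 - e) R (1 - e)].  Take [e] minimal.  Were [e] nonzero, primeness would
    give a piece [g] of [e] isomorphic to an idempotent of [(1 - e) R (1 - e)]
    whose product with [z] is in [J]; left multiplication by the unit that
    exchanges the two moves [g] into the nilpotent part, against minimality.
    In matrix terms, an identity block is absorbed one vector at a time into the
    head of a nilpotent Jordan chain.

    Finally [M_n(R)] is Artinian when [R] is, and [J (M_n(R)) = M_n(J R)], from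
    which [J] is prime for [R] if and only if it is for [M_n(R)]. *)

(** * Units, nilpotents and the Jacobson radical *)

Section Elements.

Local Open Scope ring_scope.

Variable R : pzRingType.
Implicit Types x y a b c d e f g h r s t u v w z : R.

Lemma units1 : units (1 : R).
Proof. by exists 1; rewrite mulr1. Qed.

Lemma unitsM u v : units u -> units v -> units (u * v).
Proof.
move=> [u' [u'u uu']] [v' [v'v vv']]; exists (v' * u').
by rewrite !mulrA -(mulrA v') u'u mulr1 v'v -(mulrA u) vv' mulr1 uu'.
Qed.

Lemma units_inv u : units u -> exists2 v, units v & v * u = 1 /\ u * v = 1.
Proof. by move=> [v [vu uv]]; exists v => //; exists u. Qed.

Lemma idempotent_unit e : e * e = e -> units e -> e = 1.
Proof. by move=> ee [v [ve _]]; rewrite -[e]mul1r -ve -mulrA ee. Qed.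

Lemma idempotent_compl e : e * e = e -> (1 - e) * (1 - e) = 1 - e.
Proof. by move=> ee; rewrite mulrBl mul1r mulrBr mulr1 ee subrr subr0. Qed.

Lemma nilpotents_exp x n : x ^+ n = 0 -> nilpotents x.
Proof. by move=> xn0; exists n.+1; rewrite exprS xn0 mulr0. Qed.

Lemma nilpotents_mulC x y : nilpotents (x * y) -> nilpotents (y * x).
Proof.
move=> [n [_ xyn]]; apply: (@nilpotents_exp _ n.+1).
have -> : (y * x) ^+ n.+1 = y * (x * y) ^+ n * x; last first.
  by rewrite xyn mulr0 mul0r.
elim: n {xyn} => [|n IHn]; first by rewrite expr1 expr0 mulr1.
by rewrite exprSr IHn [in RHS]exprSr !mulrA.
Qed.

(** Jacobson's lemma: if [v] inverts [1 + x y], then [1 - y v x] inverts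
    [1 + y x]. *)
Lemma unitsD1_mulC x y : units (1 + x * y) -> units (1 + y * x).
Proof.
move=> [v [vP Pv]]; exists (1 - y * v * x); split.
  rewrite mulrBl mul1r mulrDr mulr1.
  have -> : y * v * x * (y * x) = y * (v * (x * y)) * x by rewrite !mulrA.
  have -> : v * (x * y) = 1 - v by rewrite -vP mulrDr mulr1 addrAC subrr add0r.
  by rewrite mulrBr mulrBl mulr1 (addrC (y * v * x)) subrK addrK.
rewrite mulrBr mulr1 mulrDl mul1r.
have -> : y * x * (y * v * x) = y * (x * y * v) * x by rewrite !mulrA.
have -> : x * y * v = 1 - v by rewrite -Pv mulrDl mul1r addrAC subrr add0r.
by rewrite mulrBr mulrBl mulr1 (addrC (y * v * x)) subrK addrK.
Qed.

Lemma units1D_nilpotent x : nilpotents x -> units (1 + x).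
Proof.
move=> [n [_ xn0]]; pose v := \sum_(i < n) (- x) ^+ i.
have Pv : (1 + x) * v = 1.
  have xNn0 : (- x) ^+ n = 0 by rewrite exprNn xn0 mulr0.
  by rewrite -[RHS]subr0 -xNn0 -[RHS]opprB subrX1 -mulNr opprB opprK.
exists v; split=> //; rewrite -[RHS]Pv; apply/esym/commr_sum => i _.
apply/commrX/commrN; rewrite /GRing.comm mulrDl mulrDr mul1r mulr1 //.
Qed.

(** The Jacobson radical, by quasi-regularity.  Two-sided inverses make this
    one-sided formula left-right symmetric, by [unitsD1_mulC]. *)
Definition radical : set R := [set x | forall r, units (1 + r * x)].

Lemma radicalMl a x : radical x -> radical (a * x).
Proof. by move=> Jx r; rewrite mulrA; apply: Jx. Qed.

Lemma radicalMr x a : radical x -> radical (x * a).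
Proof. by move=> Jx r; rewrite mulrA; apply: unitsD1_mulC; rewrite mulrA. Qed.

Lemma unitsD_radical u x : units u -> radical x -> units (u + x).
Proof.
move=> Uu Jx; have [v _ [_ uv]] := units_inv Uu.
have -> : u + x = u * (1 + v * x) by rewrite mulrDr mulr1 mulrA uv mul1r.
exact: unitsM.
Qed.

Lemma radicalD x y : radical x -> radical y -> radical (x + y).
Proof.
by move=> Jx Jy r; rewrite mulrDr addrA; apply/unitsD_radical/radicalMl.
Qed.

Lemma radicalN x : radical x -> radical (- x).
Proof. by rewrite -mulN1r => /(radicalMl (- 1)). Qed.

Lemma radicalB x y : radical x -> radical y -> radical (x - y).
Proof. by move=> Jx /radicalN; apply: radicalD. Qed.

Lemma radical0 : radical 0.
Proof. by move=> r; rewrite mulr0 addr0; apply: units1. Qed.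

Lemma radical_idempotent e : e * e = e -> radical e -> e = 0.
Proof.
move=> ee /radicalN /(unitsD_radical units1) Ue.
move: (idempotent_unit (idempotent_compl ee) Ue) => /(congr1 (fun y => 1 - y)).
by rewrite subrr opprB addrC subrK.
Qed.

(** Powers may be computed modulo the radical. *)
Lemma radical_expD z j n : radical j -> radical ((z + j) ^+ n - z ^+ n).
Proof.
move=> Jj; elim: n => [|n IHn]; first by rewrite !expr0 subrr; apply: radical0.
have -> : (z + j) ^+ n.+1 - z ^+ n.+1
    = (z + j) * ((z + j) ^+ n - z ^+ n) + j * z ^+ n.
  by rewrite !exprS mulrBr [(z + j) * z ^+ n]mulrDl opprD !addrA addrNK.
by apply: radicalD; [apply: radicalMl | apply: radicalMr].
Qed.

(** A left ideal of nilpotent elements lies in the radical. *)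
Lemma not_radical x : ~ radical x -> exists r, ~ nilpotents (r * x).
Proof.
move=> nJx; apply: contrapT => nr; apply: nJx => r.
by apply: units1D_nilpotent; apply: contrapT => nrx; apply: nr; exists r.
Qed.

End Elements.

(** * Drazin inverses and pi-regularity *)

Section Drazin.

Local Open Scope ring_scope.

(** Such a [w] is a Drazin inverse of [x]; the idempotent [x * w] commutes with
    [x] and cuts out the part of [x] that is invertible in a corner. *)
Definition drazin_ring (R : pzRingType) : Prop :=
  forall x : R, exists w,
    [/\ w * x = x * w, x * w * w = w & nilpotents (x - x * (x * w))].

Variable R : pzRingType.
Implicit Types x y a b c d e f g h r s t u v w z : R.

Lemma drazin_idempotent x w :
  w * x = x * w -> x * w * w = w -> x * w * (x * w) = x * w.
Proof. by move=> wx xww; rewrite -mulrA (mulrA w) wx xww. Qed.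

(** Dischinger's argument.  The power [a = x ^+ m] satisfies [a = b a^2].
    Applying the hypothesis to [b] as well gives [c] with [c a = a^2], and [c]
    undoes [b] on the left of [a]; applying it to [c - a], which annihilates [a],
    then forces [(c - a) b^(j+1) a = 0] for [j = 0, 1], that is, [a = a b a] and
    [b a = a b^2 a].  Together, [a = a^2 (b^2 a)]. *)
Lemma left_pi_regular_group_regular m (x r : R) :
  (forall y, exists k s, y ^+ k = s * y ^+ k.+1) ->
  x ^+ m = r * x ^+ m.+1 ->
  exists b d, b * (x ^+ m * x ^+ m) = x ^+ m /\ x ^+ m * x ^+ m * d = x ^+ m.
Proof.
move=> lpi xm.
have xmj j : x ^+ m = r ^+ j * x ^+ (m + j).
  elim: j => [|j IHj]; first by rewrite mul1r addn0.
  by rewrite exprSr -mulrA addnS -addSn exprD (mulrA r) -xm -exprD.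
set a := x ^+ m; pose b := r ^+ m.
have ba : b * (a * a) = a by rewrite -exprD -xmj.
exists b.
have baj j : b ^+ j * a ^+ j.+1 = a.
  elim: j => [|j IHj]; first by rewrite mul1r.
  rewrite exprSr -mulrA (exprS a j.+1) (exprS a j) (mulrA a) (mulrA b) ba.
  by rewrite -exprS.
have [n [c bn]] := lpi b.
have bnj j : c * (b ^+ j.+1 * a) = b ^+ j * a.
  have e i : b ^+ i * a = b ^+ n * (b ^+ i * a ^+ n.+1).
    by rewrite mulrA -exprD addnC exprD -mulrA baj.
  by rewrite (e j.+1) (e j) exprS !mulrA -(mulrA c) -exprSr -bn.
have cbj k j : c ^+ k * (b ^+ (k + j) * a) = b ^+ j * a.
  elim: k => [|k IHk]; first by rewrite mul1r.
  by rewrite exprSr -mulrA addSn bnj.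
have cba : c * (b * a) = a by have := bnj 0%N; rewrite expr1 mul1r.
have ca : (c - a) * a = 0.
  by rewrite mulrBl -{1}ba (mulrA b) (mulrA c) cba subrr.
(* The powers of [c - a] reduce to [(c - a) c^j] because [(c - a) a = 0]. *)
have [k [d cak]] := lpi (c - a).
have caE j : (c - a) ^+ j.+1 = (c - a) * c ^+ j.
  elim: j => [|j IHj]; first by rewrite expr1 mulr1.
  by rewrite exprS IHj mulrA mulrBr ca subr0 -mulrA -exprS.
have key j : (c - a) * (b ^+ j.+1 * a) = d * ((c - a) * (b ^+ j * a)).
  have := congr1 (fun y => y * (c - a) * (b ^+ (k.+1 + j) * a)) cak.
  rewrite -(mulrA d) -!exprSr !caE -!mulrA cbj.
  by rewrite addSnnS cbj.
have aba : a = a * (b * a).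
  by have /eqP := key 0%N; rewrite expr1 mul1r ca mulr0 mulrBl cba subr_eq0 => /eqP.
have ba2 : b * a = a * (b * (b * a)).
  have /eqP := key 1%N.
  rewrite expr1 exprS expr1 -mulrA !mulrBl -aba cba subrr mulr0 subr_eq0 => /eqP <-.
  by have := bnj 1%N; rewrite exprS expr1 -mulrA.
by exists (b * (b * a)); rewrite -mulrA -ba2 -aba.
Qed.

(** For [a = x^(m+1)] with [b a^2 = a = a^2 d], the element [a d^2] is a group
    inverse [y] of [a]; it commutes with whatever commutes with [a], in
    particular with [x], so that [x^m y] is a Drazin inverse of [x]. *)
Lemma left_pi_regular_drazin :
  (forall y, exists k s, y ^+ k = s * y ^+ k.+1) -> drazin_ring R.
Proof.
move=> lpi x; have [m [r xm]] := lpi x.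
(* A positive exponent is needed to factor [a] as [x * x ^+ m]. *)
have xm1 : x ^+ m.+1 = r * x ^+ m.+2 by rewrite exprSr {1}xm -mulrA -exprSr.
have [b [d [ba ad]]] := left_pi_regular_group_regular lpi xm1.
set a := x ^+ m.+1 in ba ad.
have bad : b * a = a * d by rewrite -{1}ad mulrA ba.
pose e := a * d; pose y := e * d.
have ea : e * a = a by rewrite /e -bad -mulrA.
have ae : a * e = a by rewrite /e mulrA.
have ee : e * e = e by rewrite {1}/e -bad -mulrA ae.
have ay : a * y = e by rewrite /y mulrA ae.
have yE : y = b * e by rewrite /y /e mulrA bad.
have ya : y * a = e by rewrite yE -mulrA ea bad.
have ey : e * y = y by rewrite /y mulrA ee.
have ye : y * e = y by rewrite yE -mulrA ee.
have ax : a * x = x * a by rewrite /a -exprSr -exprS.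
have xy : x * y = y * x.
  have xe : x * e = e * (x * e).
    by rewrite -{1}ay mulrA -ax -{1}ea -(mulrA e) ax -(mulrA e) -(mulrA x) ay.
  have ex : e * x = e * x * e.
    by rewrite -{1}ya -mulrA ax -{1}ae (mulrA x) -ax !mulrA ya.
  have cex : e * x = x * e by rewrite ex xe mulrA.
  rewrite -{1}ey mulrA -cex -{1}ya -(mulrA y) ax -(mulrA y) -(mulrA x) ay.
  by rewrite -cex mulrA ye.
have xya i : x ^+ i * y = y * x ^+ i by apply/esym/commrX/esym.
exists (x ^+ m * y).
have xw : x * (x ^+ m * y) = e by rewrite mulrA -exprS.
rewrite xw; split.
- by rewrite -mulrA -xy mulrA -exprSr.
- by rewrite xya mulrA ey.
have xe : x * e = e * x by rewrite -ay -mulrA -xy mulrA -ax !mulrA.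
have fx i : (x - x * e) ^+ i.+1 = x ^+ i.+1 - x ^+ i.+1 * e.
  elim: i => [|i IHi]; first by rewrite !expr1.
  rewrite exprS IHi (exprS x i.+1) mulrBl !mulrBr.
  have -> : x * e * (x ^+ i.+1 * e) = x * e * x ^+ i.+1.
    have <- : e * x ^+ i.+1 = x ^+ i.+1 * e by apply/commrX/esym.
    by rewrite -mulrA (mulrA e) ee mulrA.
  by rewrite subrr subr0 mulrA.
by exists m.+1; rewrite fx -/a ae subrr.
Qed.

Hypothesis D : drazin_ring R.

Lemma drazin_decomposition x : exists e w,
  [/\ e * e = e, e * x = x * e, w * x = e /\ x * w = e, e * w = w /\ w * e = w
    & nilpotents (x - x * e)].
Proof.
have [w [wx xww nx]] := D x; exists (x * w), w; split=> //.
- exact: drazin_idempotent.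
- by rewrite -mulrA wx.
- by rewrite mulrA wx.
Qed.

Lemma complementary_idempotent e : e * e = e ->
  exists f, [/\ f * f = f, e * f = 0, f * e = 0 & e + f = 1].
Proof.
move=> ee; exists (1 - e); split; first exact: idempotent_compl.
- by rewrite mulrBr mulr1 ee subrr.
- by rewrite mulrBl mul1r ee subrr.
- by rewrite addrC subrK.
Qed.

(** The unit [(1 - e) - x e] cancels the invertible part of [x], leaving an
    element annihilated by [e]; being a unit, it forces [e = 0]. *)
Lemma nilpotent_of_Delta x : Delta x -> nilpotents x.
Proof.
have [e [w [ee ex [wx xw] [ew we] nx]]] := drazin_decomposition x.
have [f [ff ef fe ef1]] := complementary_idempotent ee.
have Uu : units (f - x * e).
  exists (f - w); split.
    rewrite mulrBl !mulrBr ff -ex !mulrA fe mul0r subr0.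
    by rewrite -{1}we -(mulrA w e f) ef mulr0 sub0r opprK we wx addrC.
  rewrite mulrBl !mulrBr ff -{1}ew mulrA fe mul0r subr0.
  by rewrite -!mulrA ef mulr0 sub0r opprK ew xw addrC.
move=> /(_ _ Uu) [v [_ Uv]].
have e0 : e = 0.
  rewrite -[LHS]mulr1 -Uv mulrA addrCA mulrDr ef add0r.
  by rewrite mulrBr -{1}ex mulrA ee subrr mul0r.
by move: nx; rewrite e0 mulr0 subr0.
Qed.

Lemma nilpotent_of_sqrtDelta x : sqrtDelta x -> nilpotents x.
Proof.
move=> [n [_ /nilpotent_of_Delta [m [_ xnm]]]].
by apply: (@nilpotents_exp _ _ (n * m)); rewrite exprM.
Qed.

Lemma USqrtDelta_UN : USqrtDelta_ring R -> UN_ring R.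
Proof.
move=> US a /US [u [b [Uu /nilpotent_of_sqrtDelta nb ab]]].
by exists u, b.
Qed.

(** The idempotent [x w] equals [x^n w^n], so it lies in the radical with [x^n]
    and must vanish: in particular the radical is nil. *)
Lemma nilpotent_mod_radical x n : radical (x ^+ n) -> nilpotents x.
Proof.
move=> Jxn; have [w [wx xww nx]] := D x.
have ee := drazin_idempotent wx xww.
suff e0 : x * w = 0 by move: nx; rewrite e0 mulr0 subr0.
apply: radical_idempotent => //.
have ei i : (x * w) ^+ i.+1 = x * w.
  by elim: i => [|i IHi]; rewrite ?expr1 // exprS IHi.
rewrite -(ei n) exprMn_comm; last by apply/esym.
by rewrite exprSr -mulrA; apply: radicalMr.
Qed.

Lemma nilpotentD_radical z j : nilpotents z -> radical j -> nilpotents (z + j).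
Proof.
move=> [n [_ zn]] Jj; apply: (@nilpotent_mod_radical _ n).
by have := radical_expD z n Jj; rewrite zn subr0.
Qed.

(** Lifting idempotents: a right ideal generated by an element outside the
    radical contains a nonzero idempotent, which can be taken below any
    idempotent [e] that fixes the generator on the left.  It is the Drazin
    idempotent of a non-nilpotent element [p r e]. *)
Lemma corner_idempotent e p : e * e = e -> e * p = p -> ~ radical p ->
  exists t, let g := p * t in [/\ g * g = g, e * g = g, g * e = g & g <> 0].
Proof.
move=> ee ep /not_radical [r nrp].
have [w [wx xww nx]] := D (p * r * e); set x := p * r * e in wx xww nx.
exists (r * (e * w)).
have -> : p * (r * (e * w)) = x * w by rewrite /x !mulrA.
split.
- exact: drazin_idempotent.
- by rewrite /x !mulrA ep.
- by rewrite -wx /x -!mulrA ee.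
move=> e0; move: nx; rewrite e0 mulr0 subr0 => nx; apply: nrp.
have [n [_ xn]] := nilpotents_mulC nx.
apply: nilpotents_mulC; apply: (@nilpotents_exp _ _ n.+1).
by rewrite exprS; move: xn; rewrite mulrA ep => ->; rewrite mulr0.
Qed.

End Drazin.

(** * Unit-nilpotent factorizations and primeness of the radical *)

(** The condition that the quotient by the radical is a prime ring or zero; this
    radical is Jacobson's, unrelated to the lower nilradical. *)
Definition radical_is_prime (R : pzRingType) : Prop :=
  forall h e : R, (forall s, radical (h * s * e)%R) -> radical h \/ radical e.

(** Minimality is for the usual order on idempotents, [f <= e] when
    [e f = f e = f]. *)
Definition idempotent_min (R : pzRingType) : Prop :=
  forall Q : R -> Prop, (exists e, Q e) -> (forall e, Q e -> (e * e = e)%R) ->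
    exists2 e, Q e & forall f, Q f -> (e * f = f)%R -> (f * e = f)%R -> f = e.

Section UnitNilpotent.

Local Open Scope ring_scope.

Variable R : pzRingType.
Hypotheses (D : drazin_ring R) (idemR : idempotent_min R).
Implicit Types x y a b c d e f g h r s t u v w z : R.

(** With [I = {x | h R x <= J}] and [d] minimal among the idempotents whose
    complement is in [I], one has [d I <= J]: otherwise [corner_idempotent]
    finds in [d I] an idempotent that can be subtracted from [d].  The
    complement [g] of [d] then generates [I] modulo [J], and a factorization
    [g = u b] with [b] nilpotent can be iterated modulo [J]. *)
Lemma UN_radical_is_prime : UN_ring R -> radical_is_prime R.
Proof.
move=> UN h e hRe.
pose I x := forall s, radical (h * s * x).
have IMl a x : I x -> I (a * x) by move=> Ix s; rewrite !mulrA -(mulrA h).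
have IMr a x : I x -> I (x * a) by move=> Ix s; rewrite mulrA; apply/radicalMr.
have ID x y : I x -> I y -> I (x + y).
  by move=> Ix Iy s; rewrite mulrDr; apply: radicalD.
have [||d [I1d dd] d_min] := @idemR (fun d => I (1 - d) /\ d * d = d).
- by exists 1; split; rewrite ?mulr1 // subrr => s; rewrite mulr0; apply: radical0.
- by move=> d [].
have Id x : I x -> radical (d * x).
  move=> Ix; apply: contrapT => nJ.
  have [|t [gg dg gd]] := corner_idempotent D dd _ nJ; first by rewrite mulrA dd.
  set g := _ * t in gg dg gd *; case.
  have dg_d : d - g = d.
    apply: d_min.
    - split; last by rewrite mulrBl !mulrBr dd gg dg gd subrr subr0.
      by rewrite opprB addrCA; apply: ID => //; apply: IMr; apply: IMl.
    - by rewrite mulrBr dd dg.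
    - by rewrite mulrBl dd gd.
  by move: dg_d => /eqP; rewrite subr_eq addrC -subr_eq subrr => /eqP.
have [g [gg _ _ dgE]] := complementary_idempotent dd.
have Ig : I g by have -> : g = 1 - d by rewrite -dgE addrAC subrr add0r.
have [Ug|/UN [u [b [[v [vu uv]] [n [_ bn]] gub]]]] := pselect (units g).
  left; have g1 := idempotent_unit gg Ug.
  by have := Ig 1; rewrite g1 !mulr1.
have Ib : I b by rewrite -[b]mul1r -vu -mulrA -gub; apply: IMl.
have Jk k : radical (g - u ^+ k.+1 * b ^+ k.+1).
  elim: k => [|k IHk]; first by rewrite !expr1 gub subrr; apply: radical0.
  have -> : g - u ^+ k.+2 * b ^+ k.+2
      = u * (d * b) + u * (g - u ^+ k.+1 * b ^+ k.+1) * b.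
    have -> : d * b = b - g * b by rewrite -{2}[b]mul1r -dgE mulrDl addrK.
    rewrite !mulrBr mulrBl -gub addrA (mulrA u g) subrK.
    by rewrite exprS (exprSr b) !mulrA.
  by apply: radicalD; [apply/radicalMl/Id | apply/radicalMr/radicalMl].
right; have /(radical_idempotent gg) g0 : radical g.
  by have := Jk n; rewrite exprS (exprS b) bn !mulr0 subr0.
have d1 : d = 1 by rewrite -dgE g0 addr0.
by have := Id e hRe; rewrite d1 mul1r.
Qed.

(** [Q e] says that, up to a left unit and modulo the radical, [a] is the sum of
    [e] and a nilpotent element of the complementary corner.  The Drazin
    decomposition of [a] provides such an [e]; a minimal one is shown to be
    zero, so that [u a] is nilpotent modulo the radical, hence nilpotent. *)
Lemma radical_is_prime_UN : radical_is_prime R -> UN_ring R.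
Proof.
move=> P a nUa.
pose Q e := (e * e = e /\ exists u z j,
  [/\ units u, nilpotents z, radical j, e * z = 0 /\ z * e = 0
    & u * a = e + z + j]).
have [||e [ee [u [z [j [Uu nz Jj [ez ze] ua]]]]] e_min] := @idemR Q.
- have [e [w [ee ea [wa aw] [ew we] na]]] := drazin_decomposition D a.
  have [f [ff ef fe ef1]] := complementary_idempotent ee.
  exists e; split=> //; exists (w + f), (a - a * e), 0; split=> //.
  + exists (a * e + f); split.
      rewrite mulrDl !mulrDr ff -(mulrA a) -(mulrA a) ew ef mulr0 addr0 aw.
      by rewrite -ew mulrA fe mul0r add0r.
    rewrite mulrDl !mulrDr ff (mulrA w) wa ee -ea mulrA fe mul0r add0r.
    by rewrite -we -mulrA ef mulr0 addr0.
  + exact: radical0.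
  + by rewrite mulrBl mulrBr mulrA ea -!mulrA ee !subrr.
  + rewrite addr0 mulrDl wa; congr (_ + _).
    by rewrite -ea -{2}[a]mul1r -ef1 mulrDl addrAC subrr add0r.
- by move=> e [].
have e0 : e = 0; last first.
  have nb : nilpotents (u * a).
    by rewrite ua e0 add0r; apply: nilpotentD_radical.
  have [v Uv [vu uv]] := units_inv Uu.
  by exists v, (u * a); split=> //; rewrite mulrA vu mul1r.
apply: contrapT => ne0.
have nJe : ~ radical e by move=> /(radical_idempotent ee).
have [f [ff ef fe ef1]] := complementary_idempotent ee.
have fz : f * z = z by rewrite -[RHS]mul1r -ef1 mulrDl ez add0r.
have zf : z * f = z by rewrite -[RHS]mulr1 -ef1 mulrDr ze add0r.
have nJf : ~ radical f.
  move=> /(radical_idempotent ff) f0; apply: nUa.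
  have z0 : z = 0 by rewrite -fz f0 mul0r.
  have [v Uv [vu uv]] := units_inv Uu.
  rewrite -[a]mul1r -vu -mulrA; apply: unitsM => //.
  rewrite ua z0 addr0 -[e]addr0 -f0 ef1.
  by apply: unitsD_radical => //; apply: units1.
(* The last power of [z], cut down to the corner of [f], outside the radical:
   for a nilpotent matrix it maps onto the end of the longest Jordan chains. *)
have [h [fh hf nJh Jhz]] :
    exists h, [/\ f * h = h, h * f = h, ~ radical h & radical (h * z)].
  have [n [_ zn]] := nz.
  have : radical (f * z ^+ n) by rewrite zn mulr0; apply: radical0.
  elim: n {zn} => [|n IHn]; first by rewrite mulr1.
  have [Jn _|nJn Jn1] := pselect (radical (f * z ^+ n)); first exact: IHn.
  exists (f * z ^+ n); split=> //; first by rewrite mulrA ff.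
    have cfz : f * z ^+ n = z ^+ n * f by apply: commrX; rewrite /GRing.comm fz zf.
    by rewrite cfz -mulrA ff.
  by rewrite -mulrA -exprSr.
have [s nJp] : exists s, ~ radical (e * s * h).
  apply: contrapT => ns.
  have [s||] := P e h => //.
  by apply: contrapT => nJs; apply: ns; exists s.
have [|t] := corner_idempotent D ee _ nJp; first by rewrite !mulrA ee.
set p0 := e * s * h.
have Jp0z : radical (p0 * z) by rewrite /p0 -mulrA; apply: radicalMl.
have ep0 : e * p0 = p0 by rewrite /p0 !mulrA ee.
have p0f : p0 * f = p0 by rewrite /p0 -mulrA hf.
move: p0 Jp0z ep0 p0f => p0 Jp0z ep0 p0f.
set g := p0 * t; have gE : p0 * t = g by []; clearbody g.
move=> [gg eg ge ng0]; case: ng0.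
(* [p] and [q] are inverse isomorphisms between [g], below [e], and the
   idempotent [q * p], below [f]. *)
pose p := g * p0; pose q := f * t * g.
have pq : p * q = g by rewrite /p /q !mulrA -(mulrA g) p0f -(mulrA g) gE gg.
have pf : p * f = p by rewrite /p -mulrA p0f.
have Jpz : radical (p * z) by rewrite /p -mulrA; apply: radicalMl.
have gp : g * p = p by rewrite /p mulrA gg.
have qg : q * g = q by rewrite /q -mulrA gg.
have fq : f * q = q by rewrite /q !mulrA ff.
have ep : e * p = p by rewrite -gp mulrA eg.
have pe : p * e = 0 by rewrite -pf -mulrA fe mulr0.
have qe : q * e = q by rewrite -qg -mulrA ge.
have eq0 : e * q = 0 by rewrite -fq mulrA ef mul0r.
have gq : g * q = 0 by rewrite -ge -mulrA eq0 mulr0.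
have pg : p * g = 0 by rewrite -eg mulrA pe mul0r.
have pp : p * p = 0 by rewrite -{2}ep mulrA pe mul0r.
have qq : q * q = 0 by rewrite -{1}qe -mulrA eq0 mulr0.
have qz : q * z = 0 by rewrite -qe -mulrA ez mulr0.
have gz : g * z = 0 by rewrite -ge -mulrA ez mulr0.
have zg : z * g = 0 by rewrite -eg mulrA ze mul0r.
clearbody p q.
(* The involution that exchanges [g] and [q * p]. *)
pose v := 1 - g - q * p + p + q.
have vE x : v * x = x - g * x - q * (p * x) + p * x + q * x.
  by rewrite /v !mulrDl !mulNr mul1r -(mulrA q).
have vg : v * g = q by rewrite vE gg pg mulr0 subrr subr0 addr0 add0r.
have vp : v * p = q * p by rewrite vE gp pp mulr0 subrr subr0 addr0 add0r.
have vq : v * q = g by rewrite vE gq pq qg qq subr0 subrr add0r addr0.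
have ve : v * e = e - g + q by rewrite vE ge pe mulr0 subr0 addr0 qe.
have vz : v * z = z - q * (p * z) + p * z by rewrite vE gz qz subr0 addr0.
have vv : v * v = 1.
  rewrite {2}/v !mulrDr !mulrN mulr1 vg (mulrA v q) vq gp vp.
  by rewrite /v !addrK !subrK.
have veq : e - g = e.
  apply: e_min.
  - split; first by rewrite mulrBl !mulrBr ee gg eg ge subrr subr0.
    exists (v * u), (q + z), (p * z - q * (p * z) + v * j); split.
    + by apply: unitsM => //; exists v.
    + have [n [_ zn]] := nz; apply: (@nilpotents_exp _ _ n.+1).
      suff -> : (q + z) ^+ n.+1 = z ^+ n * (q + z) by rewrite zn mul0r.
      elim: n {zn} => [|n IHn]; first by rewrite mul1r.
      rewrite exprSr IHn exprSr -!mulrA; congr (_ * _).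
      by rewrite mulrDl !mulrDr qq qz !add0r.
    + by apply: radicalD; [apply: radicalB => // |]; apply: radicalMl.
    + split; first by rewrite mulrBl !mulrDr eq0 ez gq gz addr0 subrr.
      by rewrite mulrBr !mulrDl qe ze qg zg !addr0 subrr.
    + rewrite -mulrA ua 2!mulrDr ve vz -!addrA.
      by congr (_ + (_ + (_ + (_ + _)))); rewrite addrCA.
  - by rewrite mulrBr ee eg.
  - by rewrite mulrBl ee ge.
by move: veq => /eqP; rewrite subr_eq addrC -subr_eq subrr => /eqP.
Qed.
End UnitNilpotent.

(** * Consequences of the chain conditions *)

Section Artinian.

Local Open Scope classical_set_scope.
Local Open Scope ring_scope.

(** The chain condition as a minimality principle, for ideals indexed by a
    family: without a minimal index, dependent choice builds a strictly
    decreasing chain. *)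
Lemma dcc_minimal (R : pzRingType) (P : set (set R)) (T : Type)
    (F : T -> set R) (Q : T -> Prop) :
  dcc P -> (exists t, Q t) -> (forall t, Q t -> P (F t)) ->
  exists2 t, Q t & forall t', Q t' -> F t' `<=` F t -> F t' = F t.
Proof.
move=> dccP [t0 Qt0] PF; apply: contrapT => nmin.
have /choice[next nextP] : forall t : {t | Q t}, exists t' : {t | Q t},
    F (sval t') `<=` F (sval t) /\ F (sval t') <> F (sval t).
  case=> t Qt /=; apply: contrapT => nt; apply: nmin.
  exists t => // t' Qt' sF; apply: contrapT => neF; apply: nt.
  by exists (exist _ t' Qt').
pose s k := iter k next (exist _ t0 Qt0).
have [k|k|m mP] := dccP (fun k => F (sval (s k))).
- exact/PF/svalP.
- by have [] := nextP (s k).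
- by have [_] := nextP (s m); apply; apply: (mP m.+1).
Qed.

Lemma left_artinian_pi_regular (R : pzRingType) (x : R) :
  left_artinian R -> exists k s, x ^+ k = s * x ^+ k.+1.
Proof.
move=> artR; pose F k : set R := [set y | exists s, y = s * x ^+ k].
have [||k _ kP] := @dcc_minimal R _ nat F (fun=> True) artR.
- by exists 0%N.
- move=> k _; split.
  + by exists 0; rewrite mul0r.
  + by move=> _ _ [s ->] [t ->]; exists (s - t); rewrite mulrBl.
  + by move=> a _ [s ->]; exists (a * s); rewrite mulrA.
have : F k (x ^+ k) by exists 1; rewrite mul1r.
rewrite -(kP k.+1) //; first by move=> [s xk]; exists k, s.
by move=> _ [s ->]; exists (s * x); rewrite exprS mulrA.
Qed.

Lemma left_artinian_idempotent_min (R : pzRingType) :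
  left_artinian R -> idempotent_min R.
Proof.
move=> artR Q exQ Qidem; pose F e : set R := [set y | exists s, y = s * e].
have [|e Qe eP] := @dcc_minimal R _ R F Q artR exQ.
- move=> e _; split.
  + by exists 0; rewrite mul0r.
  + by move=> _ _ [s ->] [t ->]; exists (s - t); rewrite mulrBl.
  + by move=> a _ [s ->]; exists (a * s); rewrite mulrA.
exists e => // f Qf ef fe.
have : F e e by exists 1; rewrite mul1r.
rewrite -(eP f) //; last by move=> _ [s ->]; exists (s * f); rewrite -mulrA fe.
by move=> [s es]; rewrite -ef [in RHS]es {1}es -mulrA Qidem.
Qed.

Lemma right_artinian_converse (R : pzRingType) :
  right_artinian R -> left_artinian R^c.
Proof. by []. Qed.

(** Being symmetric, the two properties return from the converse ring; there,
    the left-hand results apply to a right Artinian ring. *)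
Lemma converse_drazin (R : pzRingType) : drazin_ring R^c -> drazin_ring R.
Proof.
move=> D x; have [w [xw wwx [n [n1 nx]]]] : exists w : R,
  [/\ x * w = w * x, w * (w * x) = w & @nilpotents R^c (x - w * x * x)] := D x.
exists w; split=> //; first by rewrite xw -mulrA xw.
by exists n; split=> //; rewrite xw -revrX mulrA xw.
Qed.

Lemma converse_idempotent_min (R : pzRingType) :
  idempotent_min R^c -> idempotent_min R.
Proof.
move=> minR Q exQ Qidem; have [e Qe eP] := minR Q exQ Qidem.
by exists e => // f Qf ef fe; apply: eP.
Qed.

Lemma artinian_drazin (R : pzRingType) :
  left_artinian R \/ right_artinian R -> drazin_ring R.
Proof.
case=> [artR|/right_artinian_converse artR]; last apply: converse_drazin.
all: by apply: left_pi_regular_drazin => y; apply: left_artinian_pi_regular.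
Qed.

Lemma artinian_idempotent_min (R : pzRingType) :
  left_artinian R \/ right_artinian R -> idempotent_min R.
Proof.
case=> [|/right_artinian_converse]; first exact: left_artinian_idempotent_min.
by move=> /left_artinian_idempotent_min/converse_idempotent_min.
Qed.

End Artinian.

(** * Matrix rings *)

Section Matrices.

Local Open Scope classical_set_scope.
Local Open Scope ring_scope.

Section Entries.
Variables (R : pzRingType) (n : nat).
Implicit Types (A B : 'M[R]_n.+1) (i j k l : 'I_n.+1) (c : R).

Lemma mulmx_deltal c i k A p l :
  ((c *: delta_mx i k) *m A) p l = if p == i then c * A k l else 0.
Proof.
rewrite mxE (bigD1 k) //= !mxE eqxx andbT big1 ?addr0 => [|q /negPf qk].
  by case: eqP; rewrite ?mulr1 // mulr0 mul0r.
by rewrite !mxE qk andbF mulr0 mul0r.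
Qed.

Lemma mulmx_deltar c i k A p l :
  (A *m (c *: delta_mx i k)) p l = if l == k then A p i * c else 0.
Proof.
rewrite mxE (bigD1 i) //= !mxE eqxx /= big1 ?addr0 => [|q /negPf qk].
  by case: eqP; rewrite ?mulr1 // !mulr0.
by rewrite !mxE qk !mulr0.
Qed.

Lemma mulmx_delta_scale a b i :
  (a *: delta_mx i i) *m (b *: delta_mx i i) = (a * b) *: delta_mx i i :> 'M[R]_n.+1.
Proof.
apply/matrixP => p l; rewrite mulmx_deltal !mxE eqxx /=.
by case: eqP => _; case: eqP => _; rewrite ?mulr0 // !mulr1.
Qed.

Lemma units_delta c i :
  units (1 + c) <-> units (1 + c *: delta_mx i i : 'M[R]_n.+1).
Proof.
split=> [[w [wc cw]]|[V [VU UV]]].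
  exists (1 + (w - 1) *: delta_mx i i).
  have one (a b : R) : (1 + a) * (1 + b) = 1 ->
      (1 + a *: delta_mx i i) * (1 + b *: delta_mx i i) = 1 :> 'M[R]_n.+1.
    move=> ab; rewrite mulrDl mul1r mulrDr mulr1.
    rewrite -[_ * _ in X in _ + X]/(_ *m _) mulmx_delta_scale.
    rewrite -addrA -!scalerDl; suff -> : b + (a + a * b) = 0 by rewrite scale0r addr0.
    move/eqP: ab; rewrite mulrDl mul1r mulrDr mulr1 -addrA -subr_eq0 addrAC.
    by rewrite subrr add0r => /eqP.
  by split; apply: one; rewrite addrCA subrr addr0.
exists (V i i); split.
- have := congr1 (fun A : 'M[R]_n.+1 => A i i) VU.
  rewrite mulrDr mulr1 mxE -[V * _]/(_ *m _) mulmx_deltar eqxx mulrDr mulr1.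
  by rewrite !mxE eqxx.
- have := congr1 (fun A : 'M[R]_n.+1 => A i i) UV.
  rewrite mulrDl mul1r mxE -[_ * V]/(_ *m _) mulmx_deltal eqxx mulrDl mul1r.
  by rewrite !mxE eqxx.
Qed.

(** By Jacobson's lemma, [1 + X (c E_ij)] is invertible as soon as
    [1 + (X_ji c) E_00] is, which concerns the scalar [1 + X_ji c] only. *)
Lemma radical_delta c i j : radical c -> radical (c *: delta_mx i j : 'M[R]_n.+1).
Proof.
move=> Jc X.
have -> : c *: delta_mx i j
    = (c *: delta_mx i ord0) * (1 *: delta_mx ord0 j) :> 'M[R]_n.+1.
  apply/matrixP => p l; rewrite -[_ * _]/(_ *m _) mulmx_deltal !mxE eqxx /=.
  by case: (p == i); rewrite ?mulr0 //= mul1r.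
rewrite mulrA; apply: unitsD1_mulC; rewrite mulrA.
have -> : (1 *: delta_mx ord0 j : 'M[R]_n.+1) * X * (c *: delta_mx i ord0)
    = ((X : 'M[R]_n.+1) j i * c) *: delta_mx ord0 ord0 :> 'M[R]_n.+1.
  apply/matrixP => p l; rewrite -[LHS]/((_ *m _ *m _) _ _) mulmx_deltar.
  rewrite mulmx_deltal mul1r !mxE.
  by case: eqP => _; case: eqP => _; rewrite ?mul0r ?mulr0 ?mulr1.
exact/units_delta/Jc.
Qed.

(** One direction moves the [(i, j)] entry to the corner by multiplying with
    matrix units; the other writes [A] as a sum of the matrices of
    [radical_delta]. *)
Lemma radical_mxP A : radical A <-> forall i j, radical (A i j).
Proof.
split=> [JA i j r|JA].
  apply/(units_delta _ ord0).
  have -> : (r * A i j) *: delta_mx ord0 ord0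
      = r *: delta_mx ord0 i * A * (1 *: delta_mx j ord0) :> 'M[R]_n.+1.
    apply/matrixP => p l; rewrite -[RHS]/((_ *m _ *m _) _ _) mulmx_deltar.
    rewrite mulmx_deltal mulr1 !mxE.
    by case: eqP => _; case: eqP => _; rewrite ?mulr0 ?mulr1.
  by apply: unitsD_radical; [apply: units1 | apply/radicalMr/radicalMl].
rewrite [A]matrix_sum_delta.
apply: big_ind => [||i _]; [exact: radical0 | exact: radicalD |].
apply: big_ind => [||j _]; [exact: radical0 | exact: radicalD |].
exact: radical_delta.
Qed.

Lemma radical_is_prime_mx : radical_is_prime 'M[R]_n.+1 <-> radical_is_prime R.
Proof.
split=> [P h e hRe|P H E HME].
  have [S|JH|JE] := P (h *: delta_mx ord0 ord0) (e *: delta_mx ord0 ord0).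
  - apply/radical_mxP => p l; rewrite -[_ * _]/(_ *m _ *m _) mulmx_deltar.
    rewrite mulmx_deltal; case: eqP => _; last exact: radical0.
    by case: eqP => _; [apply: hRe | rewrite mul0r; apply: radical0].
  - by left; move/radical_mxP: JH => /(_ ord0 ord0); rewrite !mxE mulr1.
  - by right; move/radical_mxP: JE => /(_ ord0 ord0); rewrite !mxE mulr1.
have [JH|nJH] := pselect (radical H); [by left | right].
apply/radical_mxP => k l; apply: contrapT => nJE; apply: nJH.
apply/radical_mxP => i j; have [s|//|//] := P (H i j) (E k l).
have /radical_mxP /(_ i l) := HME (s *: delta_mx j k).
rewrite -[_ * _]/(_ *m _ *m _) mxE (bigD1 k) //= mulmx_deltar eqxx.
by rewrite big1 ?addr0 // => q /negPf qk; rewrite mulmx_deltar qk mul0r.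
Qed.

End Entries.

Section Columns.
Variables (R : pzRingType) (n : nat).
Local Notation M := 'M[R]_n.+1.

Definition zero_columns_before (j : nat) (A : M) : Prop :=
  forall i (l : 'I_n.+1), (l < j)%N -> A i l = 0.

(** A left ideal of matrices amounts to a submodule of the row space; these
    left ideals of [R], one for each column, are the factors of its filtration
    by the number of initial zeros.  Row [0] represents all rows, which can be
    moved there by matrix units. *)
Definition leading_coefs (I : set M) (j : 'I_n.+1) : set R :=
  [set c | exists A, [/\ I A, zero_columns_before j A & A ord0 j = c]].

Lemma left_idealD (S : pzRingType) (I : set S) x y :
  left_ideal I -> I x -> I y -> I (x + y).
Proof.
by move=> [I0 IB _] Ix Iy; rewrite -[y]opprK -[- y]sub0r; apply/IB/IB.
Qed.

Lemma leading_coefs_ideal (I : set M) j :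
  left_ideal I -> left_ideal (leading_coefs I j).
Proof.
move=> [I0 IB IM]; split.
- by exists 0; split=> // [i l _|]; rewrite mxE.
- move=> _ _ [A [IA zA <-]] [B [IB' zB <-]]; exists (A - B); split.
  + exact: IB.
  + by move=> i l lj; rewrite !mxE zA // zB // subrr.
  + by rewrite !mxE.
- move=> a _ [A [IA zA <-]]; exists (a%:M *m A); split.
  + exact: IM.
  + by move=> i l lj; rewrite mul_scalar_mx mxE zA // mulr0.
  + by rewrite mul_scalar_mx mxE.
Qed.

(** The left ideals of coefficients detect equality of nested ideals: a matrix of
    [I] is corrected by an element of [I'], built row by row, so as to gain one
    more zero column, until nothing remains. *)
Lemma leading_coefs_eq (I I' : set M) :
  left_ideal I -> left_ideal I' -> I' `<=` I ->
  (forall j, leading_coefs I j = leading_coefs I' j) -> I `<=` I'.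
Proof.
move=> idI idI' sI eqC.
suff sub d j : (j + d)%N = n.+1 -> forall A, I A -> zero_columns_before j A -> I' A.
  by move=> A IA; apply: (sub n.+1 0%N).
elim: d j => [|d IHd] j jd A IA zA.
  rewrite addn0 in jd; have -> : A = 0; last by case: idI'.
  by apply/matrixP => i l; rewrite mxE zA // jd.
have jn : (j < n.+1)%N by rewrite -jd addnS ltnS leq_addr.
have /choice [B BP] : forall i, exists B : M,
    [/\ I' B, zero_columns_before j B & B ord0 (Ordinal jn) = A i (Ordinal jn)].
  move=> i; suff : leading_coefs I (Ordinal jn) (A i (Ordinal jn)) by rewrite eqC.
  exists ((1 *: delta_mx ord0 i) *m A); split.
  - by case: idI => _ _; apply.
  - by move=> p l lj; rewrite mulmx_deltal zA // mulr0 if_same.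
  - by rewrite mulmx_deltal mul1r.
pose S := \sum_i (1 *: delta_mx i ord0) *m B i.
have SE p l : S p l = B p ord0 l.
  rewrite summxE (bigD1 p) //= mulmx_deltal eqxx mul1r big1 ?addr0 // => q.
  by rewrite mulmx_deltal eq_sym => /negPf->.
have I'S : I' S.
  apply: big_ind; first by case: idI'.
    by move=> x y; apply: left_idealD.
  by move=> i _; case: idI' => _ _; apply; case: (BP i).
rewrite -(subrK S A); apply: left_idealD => //.
apply: (IHd j.+1); first by rewrite addSnnS.
  by case: idI => _ + _; apply => //; apply: sI.
move=> i l; rewrite ltnS leq_eqVlt !mxE SE.
have [_ zB Bj] := BP i; move=> /orP[/eqP lj|lj].
  have -> : l = Ordinal jn by apply: val_inj.
  by rewrite Bj subrr.
by rewrite zA // zB // subrr.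
Qed.

Lemma left_artinian_mx : left_artinian R -> left_artinian M.
Proof.
move=> artR I idI decI.
have decI' k m : (m <= k)%N -> I k `<=` I m.
  move=> /subnK <-; elim: (k - m)%N => [|d IHd] //.
  by rewrite addSn; apply: subset_trans (decI _) IHd.
have /choice [N NP] : forall j : 'I_n.+1, exists N, forall k, (N <= k)%N ->
    leading_coefs (I k) j = leading_coefs (I N) j.
  move=> j; apply: (artR (fun k => leading_coefs (I k) j)) => k.
    exact: leading_coefs_ideal.
  by move=> c [A [IA zA Ac]]; exists A; split=> //; apply: decI.
exists (\max_j N j) => k mk; apply/seteqP; split; first exact: decI'.
apply: leading_coefs_eq => //; first exact: decI'.
move=> j; have jm : (N j <= \max_j N j)%N by apply: leq_bigmax.
by rewrite (NP j) // [RHS]NP // (leq_trans jm).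
Qed.

End Columns.

(** Transposition identifies right ideals of matrices over [R] with left ideals
    of matrices over the converse ring. *)
Lemma right_artinian_mx (R : pzRingType) n :
  right_artinian R -> right_artinian 'M[R]_n.+1.
Proof.
move=> /right_artinian_converse /(@left_artinian_mx R^c n) artM I idI decI.
pose I' k : set 'M[R^c]_n.+1 := [set A | I k (A^T : 'M[R]_n.+1)].
have [k|k A|m mP] := artM I'.
- have [I0 IB IM] := idI k; split.
  + by rewrite /I' /= trmx0.
  + by move=> A B; rewrite /I' /= linearB; apply: IB.
  + move=> A B IB'; have /(_ (A^T)) := IM _ _ IB'.
    rewrite /I' /=; congr (I k _); apply/matrixP => i j; rewrite !mxE.
    by apply: eq_bigr => q _; rewrite !mxE.
- exact: decI.
exists m => k /mP eqI; apply/funext => A.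
by have := congr1 (fun J : set 'M[R^c]_n.+1 => J (A^T)) eqI; rewrite /I' /= trmxK.
Qed.

Lemma artinian_mx (R : pzRingType) n :
  left_artinian R \/ right_artinian R ->
  left_artinian 'M[R]_n.+1 \/ right_artinian 'M[R]_n.+1.
Proof. by case=> [/left_artinian_mx|/right_artinian_mx]; [left|right]. Qed.

End Matrices.

(** * The equivalences *)

Section Equivalences.
Local Open Scope ring_scope.

Lemma UN_USqrtDelta (R : pzRingType) : UN_ring R -> USqrtDelta_ring R.
Proof.
move=> UN a /UN [u [b [Uu [n [n1 bn]] ab]]]; exists u, b; split=> //.
by exists n; split=> // v Uv; rewrite bn add0r.
Qed.

(** Both conditions amount to primeness of the radical, which [R] and its
    matrix rings share. *)
Lemma UN_mx (R : pzRingType) n :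
  left_artinian R \/ right_artinian R -> UN_ring R <-> UN_ring 'M[R]_n.+1.
Proof.
move=> artR; have artM := artinian_mx n artR.
have [DR DM] := (artinian_drazin artR, artinian_drazin artM).
have [iR iM] := (artinian_idempotent_min artR, artinian_idempotent_min artM).
split=> /UN_radical_is_prime P; apply: radical_is_prime_UN => //.
  exact/radical_is_prime_mx/P.
exact/(radical_is_prime_mx R n)/P.
Qed.

End Equivalences.

Theorem theorem3p3 (R : pzRingType) (n : nat)
    (hR : left_artinian R \/ right_artinian R) (hn : (1 <= n)%N) :
  [<-> USqrtDelta_ring R;
       UN_ring R;
       UN_ring 'M[R]_n;
       USqrtDelta_ring 'M[R]_n].
Proof.
case: n hn => // n _; have hM := artinian_mx n hR.
tfae.
- exact/USqrtDelta_UN/artinian_drazin.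
- by move=> /(UN_mx n hR).
- exact: UN_USqrtDelta.
- move=> /(USqrtDelta_UN (artinian_drazin hM)) /(UN_mx n hR).
  exact: UN_USqrtDelta.
Qed.
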